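(* The graph $C_n+P_m$ admits a $1$-super graceful labeling in which all vertices receive odd labels if (i) $n=3$ and $m\ge 4$, or (ii) $n=4$ and $m\ge 3$.
   Context: $C_n$ is the cycle on $n$ vertices, $P_m$ is the path on $m$ vertices, and $G+H$ denotes the disjoint union of graphs $G$ and $H$. For integers $a\le b$, $[a,b]$ is the set of integers between $a$ and $b$ inclusive. For $k\ge 1$, a $k$-super graceful labeling of a graph $G=(V,E)$ with $p$ vertices and $q$ edges is a bijection $f:V\cup E\to[k,k+p+q-1]$ with $f(uv)=|f(u)-f(v)|$ for every edge $uv$. *)

(* Defs.v *)
From HB Require Import structures.
From mathcomp Require Import all_boot all_order all_algebra.

Set Implicit Arguments.
Unset Strict Implicit.
Unset Printing Implicit Defensive.

Record sgraph := SGraph {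
  vertex :> finType;
  adj : rel vertex;
  adj_sym : symmetric adj;
  adj_irr : irreflexive adj
}.

Definition edges (G : sgraph) : {set {set G}} :=
  [set [set p.1; p.2] | p in [set p : G * G | adj p.1 p.2]].

Definition edge (G : sgraph) := {e : {set G} | e \in edges G}.

(* The condition i != j only matters for n = 1, where it removes the loop; for
   n >= 3 this is the cycle on n vertices. *)
Definition cycle_adj (n : nat) : rel 'I_n :=
  fun i j => (i != j) && ((j == i.+1 %% n :> nat) || (i == j.+1 %% n :> nat)).

Lemma cycle_adj_sym n : symmetric (@cycle_adj n).
Proof. by move=> i j; rewrite /cycle_adj eq_sym orbC. Qed.

Lemma cycle_adj_irr n : irreflexive (@cycle_adj n).
Proof. by move=> i; rewrite /cycle_adj eqxx. Qed.

Definition cycle_graph (n : nat) : sgraph :=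
  SGraph (@cycle_adj_sym n) (@cycle_adj_irr n).

Definition path_adj (m : nat) : rel 'I_m :=
  fun i j => (j == i.+1 :> nat) || (i == j.+1 :> nat).

Lemma path_adj_sym m : symmetric (@path_adj m).
Proof. by move=> i j; rewrite /path_adj orbC. Qed.

Lemma path_adj_irr m : irreflexive (@path_adj m).
Proof. by move=> i; rewrite /path_adj orbb ltn_eqF. Qed.

Definition path_graph (m : nat) : sgraph :=
  SGraph (@path_adj_sym m) (@path_adj_irr m).

Definition union_adj (G H : sgraph) : rel (G + H) :=
  fun x y => match x, y with
             | inl u, inl v => adj u v
             | inr u, inr v => adj u v
             | _, _ => false
             end.

Lemma union_adj_sym G H : symmetric (@union_adj G H).
Proof. by move=> [u|u] [v|v] //=; apply: adj_sym. Qed.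

Lemma union_adj_irr G H : irreflexive (@union_adj G H).
Proof. by move=> [u|u] /=; apply: adj_irr. Qed.

Definition disjoint_union (G H : sgraph) : sgraph :=
  SGraph (@union_adj_sym G H) (@union_adj_irr G H).

Definition super_graceful (k : nat) (G : sgraph) (f : G + edge G -> nat) : Prop :=
  [/\ 1 <= k,
      injective f,
      forall i : nat, (exists z, f z = i) <-> k <= i <= k + #|G| + #|edges G| - 1
    & forall (u v : G) (e : edge G), adj u v -> val e = [set u; v] ->
        f (inr e) = `|f (inl u) - f (inl v)|%N ].

(* Main.v *)
Require Import Defs.
From HB Require Import structures.
From mathcomp Require Import all_boot all_order all_algebra.
From mathcomp Require Import zify.

(** Halving the labels turns the problem into finding a graceful labeling of
    C_n + P_m, i.e. a bijection from its n + m vertices to 0, ..., n + m - 1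
    whose edge differences are 1, ..., n + m - 1. Such a labeling in which an
    end of the path is labeled 1 extends to one of C_n + P_(m+4) with the same
    property, so one explicit labeling per residue class of m modulo 4 suffices,
    apart from the exceptional C_3 + P_6. *)

Set Implicit Arguments.
Unset Strict Implicit.
Unset Printing Implicit Defensive.

Definition dist (x y : nat) : nat := `|x - y|%N.

(** * From graceful labelings to super graceful ones *)

Section Spread.

Variables (T : finType) (g : T -> nat).

(** An edge is an unordered set, so its label must not depend on an order of its ends. As
    subtraction is truncated, the maximum over both orders is the absolute difference. *)
Definition spread (A : {set T}) : nat :=
  \max_(x in A) \max_(y in A) (g x - g y).

Lemma spread_pair (u v : T) : spread [set u; v] = dist (g u) (g v).
Proof.
rewrite /spread /dist; apply/eqP; rewrite eqn_leq; apply/andP; split.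
  apply/bigmax_leqP=> x xA; apply/bigmax_leqP=> y yA.
  by move: xA yA; rewrite !inE => /orP[] /eqP-> /orP[] /eqP->; lia.
have le2 x y : x \in [set u; v] -> y \in [set u; v] ->
    g x - g y <= \max_(x in [set u; v]) \max_(y in [set u; v]) (g x - g y).
  move=> xA yA; apply: (bigmax_sup x) => //.
  exact: (bigmax_sup y).
have := le2 u v (set21 u v) (set22 u v).
by have := le2 v u (set22 u v) (set21 u v); lia.
Qed.

End Spread.

(* Vertices get the odd labels [2x + 1] and edges the even labels [2|x - y|], so
   that a graceful labeling [g] of a graph with one more vertex than edges is
   a 1-super graceful one up to scaling. *)
Lemma super_graceful_of_graceful (G : sgraph) (g : G -> nat) (es : seq (G * G)) :
  edges G =i [seq [set p.1; p.2] | p <- es] ->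
  perm_eq (codom g) (iota 0 #|G|) ->
  perm_eq [seq dist (g p.1) (g p.2) | p <- es] (iota 1 #|G|.-1) ->
  exists f : G + edge G -> nat, super_graceful 1 f /\ forall v, odd (f (inl v)).
Proof.
move=> esE gV gE.
have spreadE : [seq spread g A | A <- [seq [set p.1; p.2] | p <- es]]
             = [seq dist (g p.1) (g p.2) | p <- es].
  by rewrite -map_comp; apply: eq_map => p /=; rewrite spread_pair.
have uE : uniq [seq dist (g p.1) (g p.2) | p <- es].
  by rewrite (perm_uniq gE) iota_uniq.
(* Distinct differences force distinct edges, so the length of [es] counts the edges. *)
have ues : uniq [seq [set p.1; p.2] | p <- es].
  by apply: (@map_uniq _ _ (spread g)); rewrite spreadE.
have cardE : #|edges G| = #|G|.-1.
  rewrite (eq_card esE) (card_uniqP ues) size_map.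
  by have := perm_size gE; rewrite size_map size_iota.
have spread_mem i :
    (exists e : edge G, spread g (val e) = i) <-> 1 <= i <= #|G|.-1.
  have -> : (1 <= i <= #|G|.-1)
          = (i \in [seq spread g A | A <- [seq [set p.1; p.2] | p <- es]]).
    by rewrite spreadE (perm_mem gE) mem_iota; lia.
  split=> [[e <-]|/mapP[A]].
    by apply: map_f; rewrite -esE; apply: valP.
  by rewrite -esE => AE ->; exists (exist _ A AE).
have g_mem i : (exists v, g v = i) <-> i < #|G|.
  have -> : (i < #|G|) = (i \in codom g) by rewrite (perm_mem gV) mem_iota.
  by split=> [[v <-]|/codomP[v ->]]; [apply: codom_f | exists v].
have g_inj : injective g.
  by apply/injectiveP; rewrite /injectiveb /dinjectiveb (perm_uniq gV) iota_uniq.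
exists (fun z => match z with
                 | inl v => (g v).*2.+1
                 | inr e => (spread g (val e)).*2
                 end).
split; last by move=> v /=; rewrite odd_double.
split=> //.
- move=> [u|d] [v|e] /=; [|lia|lia|].
    by move=> guv; congr inl; apply: g_inj; lia.
  move=> /double_inj sde; congr inr; apply: val_inj.
  have /dinjectiveP inj : dinjectiveb (spread g) (edges G).
    have perm_es : perm_eq (enum (edges G)) [seq [set p.1; p.2] | p <- es].
      by apply: uniq_perm => //; [apply: enum_uniq | move=> A; rewrite mem_enum].
    by rewrite /dinjectiveb (perm_uniq (perm_map _ perm_es)) spreadE.
  by apply: inj => //; apply: valP.
- move=> i; rewrite cardE; split=> [[[v|e] <-]|i_range].
  + have /g_mem : exists w, g w = g v by exists v.
    by lia.
  + have /spread_mem : exists d : edge G, spread g (val d) = spread g (val e) by exists e.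
    by lia.
  (* The range is 1, ..., 2|G| - 1: its odd numbers belong to the vertices, its even ones to the
     edges. *)
  have [odd_i|even_i] := boolP (odd i).
    have /g_mem[v gv] : i./2 < #|G| by lia.
    by exists (inl v); lia.
  have /spread_mem[e ge] : 1 <= i./2 <= #|G|.-1 by lia.
  by exists (inr e); lia.
- by move=> u v e _ /= ->; rewrite spread_pair /dist; lia.
Qed.

(** * Labelings of $C_n+P_m$ as pairs of sequences *)

Definition path_diffs (p : seq nat) : seq nat :=
  if p is x :: p' then pairmap dist x p' else [::].

Definition cycle_diffs (c : seq nat) : seq nat :=
  if c is x :: c' then pairmap dist x (rcons c' x) else [::].

(** [c] and [p] list the labels in order along the cycle and the path. Being boolean, the condition
    is checked by computation on concrete labelings. *)
Definition graceful_pair (c p : seq nat) : bool :=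
  perm_eq (c ++ p) (iota 0 (size c + size p)) &&
  perm_eq (cycle_diffs c ++ path_diffs p) (iota 1 (size c + size p).-1).

Section CyclePath.

Variables n m : nat.
Hypotheses (n_gt1 : 1 < n) (m_gt0 : 0 < m).

Let G := disjoint_union (cycle_graph n) (path_graph m).

(** Reduction modulo [n] makes the successor of the last cycle vertex the first one. *)
Definition cvertex (i : nat) : G := inl (Ordinal (ltn_pmod i (ltnW n_gt1))).
Definition pvertex (i : nat) : G := inr (Ordinal (ltn_pmod i m_gt0)).

Definition cycle_path_edges : seq (G * G) :=
  [seq (cvertex i, cvertex i.+1) | i <- iota 0 n] ++
  [seq (pvertex i, pvertex i.+1) | i <- iota 0 m.-1].

Lemma edges_cycle_path :
  edges G =i [seq [set p.1; p.2] | p <- cycle_path_edges].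
Proof.
move=> A; apply/imsetP/mapP => [[[u v]]|[[u v]]]; last first.
  move=> uvE ->; exists (u, v) => //; rewrite inE /=.
  move: uvE; rewrite mem_cat => /orP[] /mapP[i]; rewrite mem_iota => i_lt [-> ->] /=.
    rewrite /cycle_adj -val_eqE /= [i %% n]modn_small; last by lia.
    rewrite eqxx andbT; have [i_last|i_neq] := eqVneq i.+1 n.
      by rewrite i_last modnn; lia.
    by rewrite modn_small; lia.
  by rewrite /path_adj /= !modn_small ?eqxx //; lia.
rewrite inE /=.
(* Each edge is listed in its forward direction only; a backward pair gives the same set. *)
have fwd_c (i j : 'I_n) : j = i.+1 %% n :> nat ->
    (inl i, inl j) \in cycle_path_edges.
  move=> ij; rewrite mem_cat; apply/orP; left; apply/mapP.
  exists (i : nat); first by rewrite mem_iota add0n ltn_ord.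
  by congr (inl _, inl _); apply: val_inj => //=; rewrite modn_small.
have fwd_p (i j : 'I_m) : j = i.+1 :> nat ->
    (inr i, inr j) \in cycle_path_edges.
  move=> ij; rewrite mem_cat; apply/orP; right; apply/mapP.
  have j_lt := ltn_ord j; exists (i : nat); first by rewrite mem_iota; lia.
  by congr (inr _, inr _); apply: val_inj => //=; rewrite modn_small //; lia.
case: u v => [i|i] [j|j] //=.
  move=> /andP[_ /orP[] /eqP ij] ->; first by exists (inl i, inl j); first exact: fwd_c.
  by exists (inl j, inl i); [exact: fwd_c | rewrite setUC].
move=> /orP[] /eqP ij ->; first by exists (inr i, inr j); first exact: fwd_p.
by exists (inr j, inr i); [exact: fwd_p | rewrite setUC].
Qed.

Lemma super_graceful_of_pair (c p : seq nat) :
  size c = n -> size p = m -> graceful_pair c p ->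
  exists f : G + edge G -> nat, super_graceful 1 f /\ forall v, odd (f (inl v)).
Proof.
move=> sc sp /andP[]; rewrite sc sp => labV labE.
pose g (v : G) : nat :=
  match v with inl i => nth 0 c (val i) | inr j => nth 0 p (val j) end.
have cardG : #|G| = n + m by rewrite card_sum !card_ord.
apply: (@super_graceful_of_graceful G g cycle_path_edges); rewrite ?cardG.
- exact: edges_cycle_path.
- suff -> : codom g = c ++ p by [].
  (* A sum type is enumerated with its left summand first, so the cycle labels precede the path
     labels. *)
  rewrite /codom /image_mem enumT unlock /= /sum_enum map_cat -!map_comp -!enumT.
  congr (_ ++ _).
    rewrite (eq_map (g := nth 0 c \o val)) // map_comp val_enum_ord -sc.
    exact: mkseq_nth.
  rewrite (eq_map (g := nth 0 p \o val)) // map_comp val_enum_ord -sp.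
  exact: mkseq_nth.
- suff -> : [seq dist (g q.1) (g q.2) | q <- cycle_path_edges]
          = cycle_diffs c ++ path_diffs p by [].
  rewrite map_cat -!map_comp; congr (_ ++ _).
    case: c sc {labV labE} @g => [|x c] /= sc; first by lia.
    apply: (@eq_from_nth _ 0); first by rewrite size_map size_iota size_pairmap size_rcons.
    move=> i; rewrite size_map size_iota => i_lt.
    rewrite (nth_map 0) ?size_iota // nth_iota // add0n.
    rewrite (nth_pairmap 0) ?size_rcons ?sc //= [i %% n]modn_small //.
    rewrite -rcons_cons nth_rcons /= sc i_lt nth_rcons.
    (* The closing edge meets the copy of the head [x] appended by [rcons]. *)
    have [/eqP i_last|i_neq] := boolP (i.+1 == n).
      by rewrite i_last modnn /= ifF ?ifT //; lia.
    by rewrite modn_small ?ifT //; lia.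
  case: p sp {labV labE} @g => [|x p] /= sp; first by lia.
  apply: (@eq_from_nth _ 0); first by rewrite size_map size_iota size_pairmap; lia.
  move=> i; rewrite size_map size_iota => i_lt.
  rewrite (nth_map 0) ?size_iota // nth_iota // add0n.
  rewrite (nth_pairmap 0) /=; last by lia.
  by rewrite !modn_small //; lia.
Qed.

End CyclePath.

(** * Lengthening the path by four vertices *)

Lemma pairmap_dist_add (k x : nat) (s : seq nat) :
  pairmap dist (k + x) (map (addn k) s) = pairmap dist x s.
Proof.
elim: s x => //= y s IHs x; rewrite IHs; congr (_ :: _).
by rewrite /dist; lia.
Qed.

Lemma cycle_diffs_add (k : nat) (c : seq nat) :
  cycle_diffs (map (addn k) c) = cycle_diffs c.
Proof. by case: c => //= x c; rewrite -map_rcons pairmap_dist_add. Qed.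

(* With [N] labels in use, shifting them by 2 frees the labels 0, 1, N+2, N+3;
   the new start 1, N+2, 0, N+3, 3 of the path has the differences
   N+1, N+2, N+3, N. *)
Lemma graceful_pair_step (c p : seq nat) (N := size c + (size p).+1) :
  graceful_pair c (1 :: p) ->
  graceful_pair (map (addn 2) c) [:: 1, N.+2, 0, N.+3, 3 & map (addn 2) p].
Proof.
rewrite /graceful_pair /= !size_map -/N => /andP[labV labE].
have -> : size c + (size p).+1.+4 = N + 4 by rewrite /N; lia.
have -> : (N + 4).-1 = N.-1 + 4 by rewrite /N; lia.
apply/andP; split.
  have -> : iota 0 (N + 4) = [:: 0; 1] ++ map (addn 2) (iota 0 N) ++ [:: N.+2; N.+3].
    by rewrite -iotaDl (_ : N + 4 = 2 + (N + 2)) ?iotaD //; lia.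
  apply: (@perm_trans _ ([:: 0; 1] ++ map (addn 2) (c ++ 1 :: p) ++ [:: N.+2; N.+3])).
    apply/permP => a; rewrite /= !map_cat /= !count_cat /= addn1.
    by lia.
  by rewrite perm_cat2l perm_cat2r; apply: perm_map.
(* The entry 3 is the shifted old start 1, so all old differences survive. *)
rewrite cycle_diffs_add (pairmap_dist_add 2 1).
have -> : iota 1 (N.-1 + 4) = iota 1 N.-1 ++ [:: N; N.+1; N.+2; N.+3].
  by rewrite iotaD /= -[1 + N.-1]/(N.-1.+1) prednK // /N; lia.
apply: (@perm_trans _ ((cycle_diffs c ++ pairmap dist 1 p) ++ [:: N; N.+1; N.+2; N.+3])).
  have -> : [:: dist 1 N.+2, dist N.+2 0, dist 0 N.+3, dist N.+3 3 & pairmap dist 1 p]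
          = [:: N.+1, N.+2, N.+3, N & pairmap dist 1 p].
    by rewrite /dist; congr [:: _, _, _, _ & _]; lia.
  by apply/permP => a; rewrite !count_cat /=; lia.
by rewrite perm_cat2r.
Qed.

Lemma graceful_pair_iter (k : nat) (c p : seq nat) :
  graceful_pair c (1 :: p) ->
  exists c' p', [/\ size c' = size c, size p' = size p + 4 * k
                  & graceful_pair c' (1 :: p')].
Proof.
move=> gcp; elim: k => [|k [c' [p' [sc' sp' gcp']]]]; first by exists c, p; rewrite addn0.
exists (map (addn 2) c'); eexists; split; last exact: graceful_pair_step gcp'.
  by rewrite size_map.
by rewrite /= size_map sp'; lia.
Qed.

Lemma graceful_pair_extend (m : nat) (c p : seq nat) :
  graceful_pair c (1 :: p) -> (size p).+1 <= m -> m = (size p).+1 %[mod 4] ->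
  exists c' p', [/\ size c' = size c, size p' = m & graceful_pair c' p'].
Proof.
move=> gcp le_pm m_mod.
have [c' [p' [sc' sp' gcp']]] := graceful_pair_iter ((m - (size p).+1) %/ 4) gcp.
by exists c', (1 :: p'); split=> //=; rewrite sp'; lia.
Qed.

(** * Explicit labelings for each residue class *)

(* A triangle and P_6 admit no graceful labeling whose path starts with 1: the
   class of 2 mod 4 starts at P_10, and P_6 is treated separately. *)
Lemma graceful_pair_triangle (m : nat) : 4 <= m ->
  exists c p, [/\ size c = 3, size p = m & graceful_pair c p].
Proof.
move=> m_ge4; have [->|m_neq6] := eqVneq m 6.
  by exists [:: 2; 3; 5], [:: 4; 8; 0; 7; 1; 6].
have : m %% 4 < 4 by rewrite ltn_mod.
case m_mod: (m %% 4) => [|[|[|[|]]]] // _.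
(* The starting paths, whose leading 1 is not written, are P_4, P_5, P_10 and P_7. *)
- by apply: (@graceful_pair_extend m [:: 2; 3; 5] [:: 6; 0; 4]).
- by apply: (@graceful_pair_extend m [:: 2; 4; 5] [:: 6; 0; 7; 3]) => //=; lia.
- by apply: (@graceful_pair_extend m [:: 5; 6; 8] [:: 10; 2; 12; 0; 11; 4; 9; 3; 7]) => //=; lia.
- by apply: (@graceful_pair_extend m [:: 3; 5; 6] [:: 7; 2; 9; 0; 8; 4]) => //=; lia.
Qed.

Lemma graceful_pair_square (m : nat) : 3 <= m ->
  exists c p, [/\ size c = 4, size p = m & graceful_pair c p].
Proof.
move=> m_ge3; have : m %% 4 < 4 by rewrite ltn_mod.
case m_mod: (m %% 4) => [|[|[|[|]]]] // _.
(* The starting paths are P_4, P_5, P_6 and P_3. With a path on l vertices the square is 0, l+2, 2,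
   l+3; it uses the differences l, ..., l+3 and leaves 1, ..., l-1 to the path. *)
- by apply: (@graceful_pair_extend m [:: 0; 6; 2; 7] [:: 4; 3; 5]) => //=; lia.
- by apply: (@graceful_pair_extend m [:: 0; 7; 2; 8] [:: 5; 4; 6; 3]) => //=; lia.
- by apply: (@graceful_pair_extend m [:: 0; 8; 2; 9] [:: 6; 3; 7; 5; 4]) => //=; lia.
- by apply: (@graceful_pair_extend m [:: 0; 5; 2; 6] [:: 3; 4]).
Qed.

Theorem theorem4p10 (n m : nat) :
  (n = 3 /\ 4 <= m) \/ (n = 4 /\ 3 <= m) ->
  exists f : disjoint_union (cycle_graph n) (path_graph m)
             + edge (disjoint_union (cycle_graph n) (path_graph m)) -> nat,
    super_graceful 1 f /\ forall v, odd (f (inl v)).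
Proof.
move=> nm.
have [c [p [sc sp gcp]]] :
    exists c p, [/\ size c = n, size p = m & graceful_pair c p].
  case: nm => [[-> m_ge4]|[-> m_ge3]].
    exact: graceful_pair_triangle.
  exact: graceful_pair_square.
have n_gt1 : 1 < n by lia.
have m_gt0 : 0 < m by lia.
exact: (super_graceful_of_pair n_gt1 m_gt0 sc sp gcp).
Qed.
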